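(* Let $A,B,C,W,V,Q,R$ and $\sigma_1,\dots,\sigma_n$ be the network matrices and per-coordinate privacy noise levels described in the context (so $A=\mathrm{diag}(A_1,\dots,A_N)$, $W=\mathrm{diag}(W_1,\dots,W_N)$ with each $W_i\succ 0$, $C=\mathrm{diag}(C_1,\dots,C_N)$, $V=\mathrm{diag}(\sigma_1^2,\dots,\sigma_n^2)$). Assume: (1) each $C_i$ is square and diagonal; (2) $Q\succ 0$, $R\succ 0$, the pair $(A,B)$ is controllable, and there is a matrix $F$ such that $C=F^TF$ and the pair $(A,F)$ is observable; (3) $\Sigma$ is the unique positive semidefinite solution of the discrete algebraic Riccati equation $$\Sigma = A\big(\Sigma-\Sigma C^T(C\Sigma C^T+V)^{-1}C\Sigma\big)A^T+W$$ (i.e. $\Sigma$ is the steady-state a priori error covariance of the Kalman filter for the system in the context); (4) setting $\gamma_i=\dfrac{\sigma_i^2W_{ii}}{\sigma_i^2+C_{ii}^2W_{ii}}$ for $i\in\{1,\dots,n\}$, $\Gamma=\mathrm{diag}(\gamma_1,\dots,\gamma_n)$ and $\eta=s_n^2(A)\lambda_1(\Gamma)+\lambda_n(W)$, one has $$s_1^2(A)<1+\big(s_n^2(A)\lambda_1(\Gamma)+\lambda_n(W)\big)\cdot\min_{1\le i\le n}\frac{C_{ii}^2}{\sigma_i^2}.$$ Then $$\log\det\Sigma<\left(\frac{\lambda_1(W)}{1+\eta\,\lambda_n(C^TV^{-1}C)-s_1^2(A)}\right)\sum_{i=1}^n s_i^2(A)+\mathrm{tr}(W),$$ where $$\eta\,\lambda_n(C^TV^{-1}C)=s_n^2(A)\cdot\max_{1\le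 i\le n}\frac{\sigma_i^2W_{ii}}{\sigma_i^2+C_{ii}^2W_{ii}}\cdot\min_{1\le i\le n}\frac{C_{ii}^2}{\sigma_i^2}+\lambda_n(W)\cdot\min_{1\le i\le n}\frac{C_{ii}^2}{\sigma_i^2},$$ and this is the only term of the right-hand side of the bound that depends on the privacy noise levels $\sigma_1,\dots,\sigma_n$.
   Context: Notation: $\lambda_i(\cdot)$ and $s_i(\cdot)$ denote the $i$-th largest eigenvalue and $i$-th largest singular value of a matrix; $P\succ0$ ($P\succeq 0$) means $P$ is (symmetric) positive definite (semidefinite), and $P\succeq Q$ means $P-Q\succeq0$; $\log$ is the natural logarithm; $\mathrm{diag}(P_1,\dots,P_k)$ is the block diagonal matrix (direct sum) with blocks $P_1,\dots,P_k$; $M_{ii}$ is the $i$-th diagonal entry of $M$. Setting: there are $N$ agents; agent $i$ has state $x_i(k)\in\mathbb{R}^{n_i}$ and input $u_i(k)\in\mathbb{R}^{m_i}$, with $n=\sum_i n_i$, $m=\sum_i m_i$. Its dynamics are $x_i(k+1)=A_ix_i(k)+B_iu_i(k)+w_i(k)$ with $A_i\in\mathbb{R}^{n_i\times n_i}$, $B_i\in\mathbb{R}^{n_i\times m_i}$ constant, and uncorrelated process noise $w_i(k)\sim\mathcal{N}(0,W_i)$, $0\prec W_i\in\mathbb{R}^{n_i\times n_i}$. The agent reports the noisy output $\bar y_i(k)=C_ix_i(k)+v_i(k)$, with $C_i\in\mathbb{R}^{n_i\times n_i}$ constant and Gaussian privacy noise $v_i(k)$. At network level, $A=\mathrm{diag}(A_1,\dots,A_N)\in\mathbb{R}^{n\times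 n}$, $B=\mathrm{diag}(B_1,\dots,B_N)\in\mathbb{R}^{n\times m}$, $C=\mathrm{diag}(C_1,\dots,C_N)\in\mathbb{R}^{n\times n}$, $W=\mathrm{diag}(W_1,\dots,W_N)$, and $$x(k+1)=Ax(k)+Bu(k)+w(k),\qquad \bar y(k)=Cx(k)+v(k),\qquad w(k)\sim\mathcal{N}(0,W),\ v(k)\sim\mathcal{N}(0,V).$$ The control objective is to minimize the average cost $\lim_{K_f\to\infty}\frac1{K_f}\sum_{k=1}^{K_f}\big(x(k)^TQx(k)+u(k)^TRu(k)\big)$ with $Q\in\mathbb{R}^{n\times n}$, $R\in\mathbb{R}^{m\times m}$. Privacy noise levels: each coordinate $j\in\{1,\dots,n\}$ of the network output carries Gaussian noise of standard deviation $\sigma_j>0$, the same value for all coordinates belonging to one agent, and $V=\mathrm{diag}(\sigma_1^2,\dots,\sigma_n^2)$. For coordinates belonging to agent $i$ this value is at least $\kappa(\delta_i,\epsilon_i)\,s_1(C_i)\,b_i$, where $\epsilon_i>0$, $\delta_i\in(0,1/2)$ are the agent's privacy parameters, $b_i>0$ its adjacency parameter, $\kappa(\delta,\epsilon)=\frac1{2\epsilon}\big(K_\delta+\sqrt{K_\delta^2+2\epsilon}\big)$, $K_\delta=\mathcal{Q}^{-1}(\delta)$ and $\mathcal{Q}(y)=\frac1{\sqrt{2\pi}}\int_y^\infty e^{-z^2/2}\,dz$. *)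

(* Defs.v *)
From mathcomp Require Import all_boot all_order all_algebra.
From mathcomp Require Import all_classical all_reals all_analysis.
From mathcomp Require polyrcf.

Set Implicit Arguments.
Unset Strict Implicit.
Unset Printing Implicit Defensive.

Import Order.TTheory GRing.Theory Num.Theory.
Local Open Scope ring_scope.

Section MatrixNotions.
Variable R : realType.

Definition posdef n (M : 'M[R]_n) : Prop :=
  M^T = M /\ forall x : 'cV[R]_n, x != 0 -> 0 < (x^T *m M *m x) 0 0.

Definition possemidef n (M : 'M[R]_n) : Prop :=
  M^T = M /\ forall x : 'cV[R]_n, 0 <= (x^T *m M *m x) 0 0.

(* The real eigenvalues in nonincreasing order, repeated according to their
   algebraic multiplicity; for a symmetric matrix these are all n of them. *)
Definition spectrum n (M : 'M[R]_n) : seq R :=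
  sort >=%R (flatten [seq nseq (mup x (char_poly M)) x
                     | x <- polyrcf.rootsR (char_poly M)]).

(* The index starts at 1: [eigval M 1] is the largest eigenvalue of M and
   [eigval M n] the smallest one. *)
Definition eigval n (M : 'M[R]_n) (k : nat) : R := nth 0 (spectrum M) k.-1.

Definition singval m n (M : 'M[R]_(m, n)) (k : nat) : R :=
  Num.sqrt (eigval (M^T *m M) k).

(* Largest and smallest value of a function on a nonempty finite type; the head
   of the list of values serves as the initial value of the fold. *)
Definition fmax (I : finType) (f : I -> R) : R :=
  \big[Order.max/head 0 (codom f)]_(x <- codom f) x.

Definition fmin (I : finType) (f : I -> R) : R :=
  \big[Order.min/head 0 (codom f)]_(x <- codom f) x.

End MatrixNotions.

(* Direct sum of rectangular blocks; [\mxdiag] only covers square ones. *)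
Definition blockdiag (R : realType) N (p q : 'I_N -> nat)
    (M : forall i, 'M[R]_(p i, q i)) : 'M[R]_(\sum_i p i, \sum_i q i) :=
  \mxblock_(i < N, j < N)
    (if i == j then conform_mx (0 : 'M[R]_(p i, q j)) (M i) else 0).

Section SystemNotions.
Variable R : realType.

Fixpoint state n m (A : 'M[R]_n) (B : 'M[R]_(n, m)) (x0 : 'cV[R]_n)
    (u : nat -> 'cV[R]_m) (k : nat) : 'cV[R]_n :=
  if k is k'.+1 then A *m state A B x0 u k' + B *m u k' else x0.

Definition controllable n m (A : 'M[R]_n) (B : 'M[R]_(n, m)) : Prop :=
  forall x0 x1 : 'cV[R]_n,
    exists (T : nat) (u : nat -> 'cV[R]_m), state A B x0 u T = x1.

(* Finitely many outputs of x(k+1) = A x(k), z(k) = F x(k) determine x(0). *)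
Definition observable n p (A : 'M[R]_n) (F : 'M[R]_(p, n)) : Prop :=
  exists T : nat, forall x0 x1 : 'cV[R]_n,
    (forall k, (k < T)%N ->
       F *m iter k (mulmx A) x0 = F *m iter k (mulmx A) x1) ->
    x0 = x1.

(* Discrete algebraic Riccati equation for the a priori error covariance. *)
Definition dare n (A C W V S : 'M[R]_n) : Prop :=
  S = A *m (S - S *m C^T *m invmx (C *m S *m C^T + V) *m C *m S) *m A^T + W.

End SystemNotions.

Section GaussianMechanism.
Variable R : realType.

Definition gauss_tail (y : R) : R :=
  (Num.sqrt (2 * pi))^-1
  * \int[lebesgue_measure]_(z in `[y, +oo[%classic) expR (- (z ^+ 2) / 2).

Definition gauss_tail_inv (d : R) : R := xget 0 [set y | gauss_tail y = d]%classic.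

Definition kappa (delta eps : R) : R :=
  (2 * eps)^-1 * (gauss_tail_inv delta
                  + Num.sqrt (gauss_tail_inv delta ^+ 2 + 2 * eps)).

End GaussianMechanism.

Section Bound.
Variables (R : realType) (n : nat) (A C W : 'M[R]_n).

Definition noise_cov (sigma : 'I_n -> R) : 'M[R]_n :=
  diag_mx (\row_j sigma j ^+ 2).

Definition gam (sigma : 'I_n -> R) (i : 'I_n) : R :=
  sigma i ^+ 2 * W i i / (sigma i ^+ 2 + C i i ^+ 2 * W i i).

Definition Gam (sigma : 'I_n -> R) : 'M[R]_n := diag_mx (\row_i gam sigma i).

Definition eta (sigma : 'I_n -> R) : R :=
  singval A n ^+ 2 * eigval (Gam sigma) 1 + eigval W n.

Definition privacy_term (sigma : 'I_n -> R) : R :=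
  eta sigma * eigval (C^T *m invmx (noise_cov sigma) *m C) n.

Definition logdet_bound (sigma : 'I_n -> R) : R :=
  eigval W 1 / (1 + privacy_term sigma - singval A 1 ^+ 2)
    * (\sum_(1 <= i < n.+1) singval A i ^+ 2)
  + \tr W.

End Bound.

(* Main.v *)
Require Import Defs.
From mathcomp Require Import all_boot all_order all_algebra.
From mathcomp Require Import all_classical all_reals all_analysis.
From mathcomp Require polyrcf.
From mathcomp Require Import complex.
From mathcomp Require Import ring lra.
Import Order.TTheory GRing.Theory Num.Theory.
Local Open Scope ring_scope.

(** With D = C^T V^-1 C, d = lambda_n(D), s = lambda_1(Sigma) and P the filtered
    (a posteriori) covariance, Sigma = A P A^T + W. Testing P against the
    diagonal gain l_i = s c_i / (s c_i^2 + v_i) in Joseph's form gives P <= p I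
    with p = s / (1 + s d), so tr Sigma <= p ||A||_F^2 + tr W.

    The factor ln x < x / 2 gives ln det Sigma < tr Sigma / 2, so it is enough
    that p (1 + eta d - s_1(A)^2) <= 2 lambda_1(W), which holds because
    lambda_1(W) <= s <= s_1(A)^2 p + lambda_1(W) and
    eta <= s_1(A)^2 max gamma_i + lambda_1(W). The same estimate without the
    factor 2 would follow from s >= eta; this is avoided, since the natural
    argument for it needs lambda_1((W^-1 + D)^-1) >= max gamma_i, which is false
    for correlated W_i and non-scalar C_i. *)

Set Implicit Arguments.
Unset Strict Implicit.

(** * Spectrum and quadratic form of a real symmetric matrix *)

Definition qform {R : realType} {n} (M : 'M[R]_n) (x : 'cV[R]_n) : R :=
  (x^T *m M *m x) 0 0.

Definition sqnorm {R : realType} {n} (x : 'cV[R]_n) : R := (x^T *m x) 0 0.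

(** Both lists contain each x as often as its multiplicity as a root of the characteristic
    polynomial, so it is enough to compare counts. This gives access to [spectrum] from any
    factorization into linear factors. *)
Lemma perm_spectrum (R : realType) n (M : 'M[R]_n) (s : seq R) :
  char_poly M = \prod_(x <- s) ('X - x%:P) -> perm_eq (spectrum M) s.
Proof.
move=> cM; rewrite /spectrum perm_sort cM; set p := \prod_(x <- s) _.
have p0 : p != 0 by rewrite monic_neq0 // monic_prod_XsubC.
apply/allP => x _ /=; apply/eqP.
rewrite -(mu_prod_XsubC x s) -/p count_flatten -map_comp.
(* The copies of a root y contribute to the count of x only when y = x. *)
have -> : [seq (count_mem x \o (fun y => nseq (mup y p) y)) i | i <- polyrcf.rootsR p]
    = [seq (if y == x then mup x p else 0)%N | y <- polyrcf.rootsR p].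
  apply: eq_map => y /=; rewrite count_nseq /=.
  by case: eqP => [->|_]; rewrite ?mul1n ?mul0n.
rewrite sumnE big_map -big_mkcond /=.
have [xr|xr] := boolP (x \in polyrcf.rootsR p).
  rewrite -big_filter (@perm_big _ _ _ _ _ [:: x]) /= ?big_seq1 //.
  apply: uniq_perm => //=; first by rewrite filter_uniq // polyrcf.uniq_roots.
  move=> y; rewrite mem_filter inE.
  by case: eqP => [->|]; rewrite ?xr.
rewrite big1_seq => [|y /andP[/eqP-> ]]; last by rewrite (negPf xr).
apply/esym/mupNroot; apply: contra xr => rx.
by rewrite -(polyrcf.roots_on_rootsR p0) in_itv /= rx.
Qed.

Lemma char_poly_similar (F : fieldType) n (U A : 'M[F]_n) :
  U \in unitmx -> char_poly (invmx U *m A *m U) = char_poly A.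
Proof.
move=> Uu; rewrite /char_poly /char_poly_mx.
have /(congr1 (map_mx polyC)) := mulVmx Uu; rewrite map_mxM map_mx1 /= => UU.
have -> : 'X%:M - map_mx polyC (invmx U *m A *m U) =
    map_mx polyC (invmx U) *m ('X%:M - map_mx polyC A) *m map_mx polyC U.
  by rewrite mulmxBr mulmxBl scalar_mxC -(mulmxA 'X%:M) UU mulmx1 !map_mxM.
by rewrite !det_mulmx mulrC mulrA -det_mulmx (mulmx1C UU) det1 mul1r.
Qed.

(* The weights [q i] are |(U x)_i|^2 for a complex unitary U diagonalizing M. *)
Lemma spectral_quadratic (R : realType) n (M : 'M[R]_n) : M^T = M ->
  exists d : 'I_n -> R,
    char_poly M = \prod_(i < n) ('X - (d i)%:P) /\
    forall x : 'cV[R]_n, exists q : 'I_n -> R,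
      [/\ forall i, 0 <= q i, \sum_i q i = sqnorm x
        & qform M x = \sum_i d i * q i].
Proof.
move=> Msym; pose C : numClosedFieldType := R[i].
pose f : {rmorphism R -> C} := complex.real_complex R.
have fconj r : (f r)^* = f r by apply: complex.conjc_real.
have fRe (z : C) : z \is Num.real -> f (complex.Re z) = z.
  by move=> zr; rewrite /f /= complex.RRe_real.
have xreal p q (x : 'M[R]_(p, q)) : map_mx Num.conj (map_mx f x) = map_mx f x.
  by apply/matrixP => i j; rewrite !mxE fconj.
pose Mc := map_mx f M.
have Mherm : Mc \is hermsymmx.
  by rewrite qualifE /= expr0 scale1r /Mc map_trmx Msym xreal.
set U := spectralmx Mc; set D := spectral_diag Mc.
have Uunit : U \in unitmx := spectral_unit Mc.
have Uunitary : U \is unitarymx := spectral_unitarymx Mc.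
have McE : Mc = invmx U *m diag_mx D *m U.
  exact: (orthomx_spectralP (hermitian_normalmx Mherm)).
pose d i := complex.Re (D 0 i).
have fd i : f (d i) = D 0 i.
  by rewrite fRe //; exact: (mxOverP (hermitian_spectral_diag_real Mherm)).
exists d; split.
  apply: (map_poly_inj f); rewrite map_char_poly -/Mc map_prod_XsubC.
  rewrite McE char_poly_similar // char_poly_trig ?diag_mx_is_trig //.
  by apply: eq_bigr => i _; rewrite fd mxE eqxx mulr1n.
move=> x; pose z := U *m map_mx f x.
exists (fun i => complex.Re (`|z i 0| ^+ 2)).
(* Stated for an arbitrary diagonal e because it is used twice: e = 1 gives the squared norm of x, e
   = D gives the form of M. *)
have zD (e : 'rV_n) : \sum_i e 0 i * `|z i 0| ^+ 2 =
    ((map_mx f x)^T *m (invmx U *m diag_mx e *m U) *m map_mx f x) 0 0.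
  rewrite invmx_unitary //.
  have -> : (map_mx f x)^T *m (map_mx Num.conj U^T *m diag_mx e *m U) *m map_mx f x
      = map_mx Num.conj z^T *m diag_mx e *m z.
    by rewrite /z trmx_mul map_mxM map_trmx xreal !mulmxA.
  rewrite mul_mx_diag mxE; apply: eq_bigr => i _; rewrite [in RHS]mxE.
  have -> : (map_mx Num.conj z^T) 0 i = Num.conj (z i 0) by rewrite !mxE.
  by rewrite normCK; ring.
have fq i : f (complex.Re (`|z i 0| ^+ 2)) = `|z i 0| ^+ 2.
  by rewrite fRe // rpredX // normr_real.
split.
- move=> i; have : 0 <= `|z i 0| ^+ 2 by rewrite exprn_ge0.
  by rewrite complex.lecE /= => /andP[].
- apply: (fmorph_inj f); rewrite rmorph_sum.
  transitivity (\sum_i (const_mx 1 : 'rV[C]_n) 0 i * `|z i 0| ^+ 2).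
    by apply: eq_bigr => i _; rewrite fq [const_mx _ _ _]mxE mul1r.
  rewrite zD diag_const_mx mulmx1 mulVmx // mulmx1.
  by rewrite map_trmx -map_mxM mxE.
- apply: (fmorph_inj f); rewrite rmorph_sum.
  transitivity (\sum_i D 0 i * `|z i 0| ^+ 2).
    by rewrite zD -McE map_trmx -!map_mxM mxE.
  by apply: eq_bigr => i _; rewrite rmorphM fq fd.
Qed.

Lemma eigval1_max (R : realType) n (M : 'M[R]_n) (x : R) :
  x \in spectrum M -> x <= eigval M 1.
Proof.
have : sorted >=%R (spectrum M) := sort_sorted ge_total _.
rewrite /eigval; case: (spectrum M) => //= y s ys.
rewrite inE => /orP[/eqP->//|xs].
by have /allP/(_ _ xs) := order_path_min ge_trans ys.
Qed.

(** The size hypothesis places the index n - 1 at the end of the list, so the default value 0 of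
    [nth] is never read. *)
Lemma eigval_min (R : realType) n (M : 'M[R]_n) (x : R) :
  size (spectrum M) = n -> x \in spectrum M -> eigval M n <= x.
Proof.
move=> sz xs; have n0 : (0 < n)%N by rewrite -sz; case: (spectrum M) xs.
rewrite /eigval -(nth_index 0 xs).
have sorted_s : sorted >=%R (spectrum M) := sort_sorted ge_total _.
have : (index x (spectrum M) < size (spectrum M))%N by rewrite index_mem.
rewrite sz => xn.
apply: (sorted_leq_nth ge_trans ge_refl 0 sorted_s).
- by rewrite inE sz.
- by rewrite inE sz prednK.
- by rewrite -ltnS prednK.
Qed.

Section Symmetric.
Variables (R : realType) (n : nat) (M : 'M[R]_n).
Hypothesis Msym : M^T = M.

Lemma char_poly_spectrum : char_poly M = \prod_(x <- spectrum M) ('X - x%:P).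
Proof.
have [d [cM _]] := spectral_quadratic Msym.
rewrite (perm_big (codom d)) /=; last first.
  by apply: perm_spectrum; rewrite cM big_image.
by rewrite cM big_image.
Qed.

Lemma size_spectrum : size (spectrum M) = n.
Proof.
have := size_char_poly M; rewrite char_poly_spectrum size_prod_XsubC.
by case.
Qed.

Lemma eigval_spectrum k : (0 < k <= n)%N -> eigval M k \in spectrum M.
Proof. by case: k => //= k kn; rewrite mem_nth // size_spectrum. Qed.

Lemma mxtrace_spectrum : \tr M = \sum_(x <- spectrum M) x.
Proof.
(* The trace as a coefficient of the characteristic polynomial makes sense only for n > 0. *)
case: (posnP n) => [n0|n0].
  have /size0nil-> : size (spectrum M) = 0%N by rewrite size_spectrum.
  rewrite big_nil /mxtrace big1 // => i; by have := ltn_ord i; rewrite {2}n0.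
apply: oppr_inj; rewrite -char_poly_trace // char_poly_spectrum.
have := @coefPn_prod_XsubC _ (spectrum M).
by rewrite size_spectrum -lt0n => ->.
Qed.

Lemma det_spectrum : \det M = \prod_(x <- spectrum M) x.
Proof.
have := char_poly_det M; rewrite char_poly_spectrum coef0_prod_XsubC size_spectrum.
by move/(mulrI _) => -> //; rewrite unitrX // unitrN unitr1.
Qed.

Lemma sum_eigval : \sum_(1 <= k < n.+1) eigval M k = \tr M.
Proof.
by rewrite mxtrace_spectrum [RHS](big_nth 0) size_spectrum big_add1.
Qed.

Lemma qform_le_eigval1 (x : 'cV[R]_n) : qform M x <= eigval M 1 * sqnorm x.
Proof.
have [d [cM /(_ x)[q [q0 <- ->]]]] := spectral_quadratic Msym.
rewrite mulr_sumr ler_sum // => i _; rewrite ler_wpM2r // eigval1_max //.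
rewrite (perm_mem (_ : perm_eq _ (codom d))) ?codom_f //.
by apply: perm_spectrum; rewrite cM big_image.
Qed.

(** Take an eigenvector. Eigenvectors are rows here, hence the transpose in the witness; its squared
    norm is positive because a sum of squares vanishes only at 0. *)
Lemma spectrum_qform (a : R) : a \in spectrum M ->
  exists2 x : 'cV[R]_n, 0 < sqnorm x & qform M x = a * sqnorm x.
Proof.
rewrite -root_prod_XsubC -char_poly_spectrum -eigenvalue_root_char.
move=> /eigenvalueP[v vM v0]; exists v^T; last first.
  by rewrite /qform /sqnorm trmxK vM -scalemxAl mxE.
rewrite /sqnorm trmxK mxE lt_def sumr_ge0 ?andbT; last first.
  by move=> i _; rewrite mxE -expr2 sqr_ge0.
apply: contra v0 => /eqP /psumr_eq0P vv; apply/eqP/rowP => i; rewrite mxE.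
have /vv/(_ i isT) : forall j, true -> 0 <= v 0 j * v^T j 0.
  by move=> j _; rewrite mxE -expr2 sqr_ge0.
by rewrite mxE => /eqP; rewrite mulf_eq0 orbb => /eqP.
Qed.

Lemma eigval1_le (c : R) : (0 < n)%N ->
  (forall x : 'cV[R]_n, qform M x <= c * sqnorm x) -> eigval M 1 <= c.
Proof.
move=> n0 Mc; have [x x0 Mx] := spectrum_qform (eigval_spectrum (k := 1) n0).
by have := Mc x; rewrite Mx ler_pM2r.
Qed.

End Symmetric.

(** * Finite extrema and extreme eigenvalues of diagonal matrices *)

Lemma perm_spectrum_diag (R : realType) n (r : 'rV[R]_n) :
  perm_eq (spectrum (diag_mx r)) (codom (fun i => r 0 i)).
Proof.
apply: perm_spectrum; rewrite char_poly_trig ?diag_mx_is_trig // big_image /=.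
by apply: eq_bigr => i _; rewrite mxE eqxx.
Qed.

Section FiniteExtrema.
Variables (R : realType) (I : finType) (f : I -> R).

Lemma fmax_ge i : f i <= fmax f.
Proof. exact: (le_bigmax_seq _ (f i) xpredT id (codom_f f i) isT). Qed.

Lemma fmin_le i : fmin f <= f i.
Proof. exact: (ge_bigmin_seq _ (f i) xpredT id (codom_f f i) isT). Qed.

Hypothesis I0 : (0 < #|I|)%N.

(** The initial value of the folds is itself a value of f; this is why the maximum and the minimum
    are attained. *)
Lemma head_codom : head 0 (codom f) \in codom f.
Proof.
have : size (codom f) != 0%N by rewrite size_codom -lt0n.
by case: (codom f) => //= y s _; rewrite mem_head.
Qed.

Lemma fmax_codom : fmax f \in codom f.
Proof.
rewrite /fmax big_seq; apply: (big_ind (fun y => y \in codom f)) => //.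
  exact: head_codom.
by move=> x y xf yf; rewrite /Order.max; case: ifP.
Qed.

Lemma fmin_codom : fmin f \in codom f.
Proof.
rewrite /fmin big_seq; apply: (big_ind (fun y => y \in codom f)) => //.
  exact: head_codom.
by move=> x y xf yf; rewrite /Order.min; case: ifP.
Qed.

End FiniteExtrema.

Lemma eigval1_diag (R : realType) n (r : 'rV[R]_n) : (0 < n)%N ->
  eigval (diag_mx r) 1 = fmax (fun i => r 0 i).
Proof.
move=> n0; have ds : (diag_mx r)^T = diag_mx r by rewrite tr_diag_mx.
have pE := perm_mem (perm_spectrum_diag r).
apply: le_anti; apply/andP; split.
  have := eigval_spectrum ds (k := 1) n0; rewrite pE => /codomP[i ->].
  exact: (fmax_ge (fun i => r 0 i)).
by apply: eigval1_max; rewrite pE fmax_codom // card_ord.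
Qed.

Lemma eigvaln_diag (R : realType) n (r : 'rV[R]_n) : (0 < n)%N ->
  eigval (diag_mx r) n = fmin (fun i => r 0 i).
Proof.
move=> n0; have ds : (diag_mx r)^T = diag_mx r by rewrite tr_diag_mx.
have pE := perm_mem (perm_spectrum_diag r).
apply: le_anti; apply/andP; split.
  by apply: eigval_min; rewrite ?size_spectrum // pE fmin_codom // card_ord.
have : eigval (diag_mx r) n \in spectrum (diag_mx r).
  by apply: eigval_spectrum => //; rewrite n0 leqnn.
rewrite pE => /codomP[i ->]; exact: (fmin_le (fun i => r 0 i)).
Qed.

(** * Definiteness, congruence and operator norm bounds *)

Section QuadraticForms.
Variables (R : realType) (n : nat).
Implicit Types (A M : 'M[R]_n) (x : 'cV[R]_n) (r : 'rV[R]_n).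

Lemma sqnormE x : sqnorm x = \sum_i x i 0 ^+ 2.
Proof. by rewrite /sqnorm mxE; apply: eq_bigr => i _; rewrite mxE expr2. Qed.

Lemma sqnorm_ge0 x : 0 <= sqnorm x.
Proof. by rewrite sqnormE sumr_ge0 // => i _; rewrite sqr_ge0. Qed.

Lemma sqnorm_eq0 x : (sqnorm x == 0) = (x == 0).
Proof.
apply/eqP/eqP => [|->]; last by rewrite /sqnorm mulmx0 mxE.
rewrite sqnormE => /psumr_eq0P x0; apply/colP => i; rewrite mxE.
by apply/eqP; rewrite -sqrf_eq0 x0 // => j _; rewrite sqr_ge0.
Qed.

Lemma qformD M1 M2 x : qform (M1 + M2) x = qform M1 x + qform M2 x.
Proof. by rewrite /qform mulmxDr mulmxDl mxE. Qed.

Lemma qform_congr A M x : qform (A *m M *m A^T) x = qform M (A^T *m x).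
Proof. by rewrite /qform trmx_mul trmxK !mulmxA. Qed.

Lemma qform_tr_mul A x : qform (A^T *m A) x = sqnorm (A *m x).
Proof. by rewrite /qform /sqnorm trmx_mul !mulmxA. Qed.

Lemma qform_delta M i : qform M (delta_mx i 0) = M i i.
Proof. by rewrite /qform trmx_delta -rowE -colE !mxE. Qed.

Lemma sqnorm_delta i : sqnorm (delta_mx i 0 : 'cV[R]_n) = 1.
Proof.
rewrite sqnormE (bigD1 i) //= mxE !eqxx expr1n big1 ?addr0 // => j ji.
by rewrite mxE (negPf ji) expr0n.
Qed.

Lemma qform_diag r x : qform (diag_mx r) x = \sum_i r 0 i * x i 0 ^+ 2.
Proof.
rewrite /qform mul_mx_diag mxE; apply: eq_bigr => i _.
by rewrite !mxE; ring.
Qed.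

Lemma posdef_qform M x : posdef M -> x != 0 -> 0 < qform M x.
Proof. by case=> _; apply. Qed.

Lemma possemidef_qform M x : possemidef M -> 0 <= qform M x.
Proof. by case=> _; apply. Qed.

Lemma posdef_possemidef M : posdef M -> possemidef M.
Proof.
case=> Ms Mp; split=> // x; have [->|/Mp/ltW//] := eqVneq x 0.
by rewrite mulmx0 mxE.
Qed.

Lemma posdef_unitmx M : posdef M -> M \in unitmx.
Proof.
move=> Mp; rewrite unitmxE unitfE; apply/det0P => -[v v0 vM].
have : 0 < qform M v^T.
  by rewrite posdef_qform // -(inj_eq trmx_inj) trmxK trmx0.
by rewrite /qform trmxK vM mul0mx mxE ltxx.
Qed.

Lemma possemidef_congr A M : possemidef M -> possemidef (A *m M *m A^T).
Proof.
case=> Ms Mp; split=> [|x]; first by rewrite !trmx_mul trmxK Ms mulmxA.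
by rewrite -/(qform _ x) qform_congr; exact: Mp.
Qed.

Lemma possemidefD_posdef M1 M2 :
  possemidef M1 -> posdef M2 -> posdef (M1 + M2).
Proof.
move=> M1p M2p; split=> [|x x0].
  by rewrite linearD /= (proj1 M1p) (proj1 M2p).
rewrite -/(qform _ x) qformD ltr_wpDl ?posdef_qform //.
exact: possemidef_qform.
Qed.

Lemma posdef_diag r : (forall i, 0 < r 0 i) -> posdef (diag_mx r).
Proof.
move=> r0; split=> [|x x0]; first by rewrite tr_diag_mx.
have rx i : 0 <= r 0 i * x i 0 ^+ 2 by rewrite mulr_ge0 ?sqr_ge0 // ltW.
rewrite -/(qform _ x) qform_diag lt_def sumr_ge0 // andbT.
apply: contra x0 => /eqP /psumr_eq0P rx0; apply/eqP/colP => i; rewrite mxE.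
have /eqP := rx0 (fun j _ => rx j) i isT.
by rewrite mulf_eq0 gt_eqF // sqrf_eq0 => /eqP.
Qed.

Lemma mxtrace_le_qform M (c : R) (g : 'cV[R]_n -> R) :
  (forall x, qform M x <= c * g x) ->
  \tr M <= c * \sum_i g (delta_mx i 0).
Proof.
move=> Mg; rewrite mulr_sumr ler_sum // => i _.
by rewrite -(qform_delta M).
Qed.

Lemma posdef_spectrum_gt0 M (a : R) : posdef M -> a \in spectrum M -> 0 < a.
Proof.
move=> Mp /(spectrum_qform (proj1 Mp))[x x0 Mx].
have : 0 < qform M x by rewrite posdef_qform // -sqnorm_eq0 gt_eqF.
by rewrite Mx pmulr_lgt0.
Qed.

Lemma eigval1_gt0 M : (0 < n)%N -> posdef M -> 0 < eigval M 1.
Proof.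
move=> n0 Mp; apply: (posdef_spectrum_gt0 Mp).
exact: (eigval_spectrum (proj1 Mp) (k := 1) n0).
Qed.

Lemma sqnorm_mul_le A x :
  sqnorm (A *m x) <= eigval (A^T *m A) 1 * sqnorm x.
Proof.
by rewrite -qform_tr_mul qform_le_eigval1 // trmx_mul trmxK.
Qed.

(** A matrix and its transpose have the same operator norm. With z = A^T x and y = A z one has <y,
    x> = |z|^2, so expanding 0 <= |y - a x|^2 and using |y|^2 <= a |z|^2 yields a |z|^2 <= a^2
    |x|^2. No singular value decomposition is involved. *)
Lemma sqnorm_trmul_le A (a : R) x : 0 <= a ->
  (forall y, sqnorm (A *m y) <= a * sqnorm y) ->
  sqnorm (A^T *m x) <= a * sqnorm x.
Proof.
move=> a_ge0 Aa; set z := A^T *m x; set y := A *m z.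
have yz : y^T *m x = z^T *m z by rewrite /y trmx_mul -mulmxA.
have expand b : sqnorm (y - b *: x) = sqnorm y - 2 * b * sqnorm z + b ^+ 2 * sqnorm x.
  have xy : (x^T *m y) 0 0 = sqnorm z.
    by rewrite /sqnorm -yz -[x^T *m y]trmxK trmx_mul trmxK [LHS]mxE.
  have -> : sqnorm (y - b *: x) =
      (y^T *m y) 0 0 - b * (y^T *m x) 0 0 - b * (x^T *m y) 0 0 + b ^+ 2 * (x^T *m x) 0 0.
    have tE : (y - b *: x)^T = y^T - b *: x^T by rewrite linearB /= linearZ.
    rewrite /sqnorm tE mulmxBl !mulmxBr.
    rewrite -!scalemxAl -!scalemxAr !mxE; ring.
  rewrite xy yz -/(sqnorm z) -/(sqnorm y) -/(sqnorm x); ring.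
have [a0|a0] := ltP 0 a.
  have := sqnorm_ge0 (y - a *: x); rewrite expand => h.
  rewrite -(ler_pM2l a0); have := Aa z; rewrite -/y; nra.
(* Here a = 0, so division by a is impossible; instead y = 0 and |z|^2 = <y, x> = 0. *)
have y0 : y = 0.
  apply/eqP; rewrite -sqnorm_eq0 eq_le sqnorm_ge0 andbT.
  by rewrite (le_trans (Aa z)) // mulr_le0_ge0 // sqnorm_ge0.
have -> : sqnorm z = 0 by rewrite /sqnorm -yz y0 trmx0 mul0mx mxE.
by rewrite mulr_ge0 ?sqnorm_ge0.
Qed.

End QuadraticForms.

(** * The filtered covariance and its bound by a suboptimal gain *)

Section RiccatiUpdate.
Variables (R : realType) (n : nat) (C V S : 'M[R]_n).
Hypotheses (Vp : posdef V) (Sp : possemidef S).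

Definition filtered_cov : 'M[R]_n :=
  S - S *m C^T *m invmx (C *m S *m C^T + V) *m C *m S.

Let G := C *m S *m C^T + V.
Let K := S *m C^T *m invmx G.

Let Gp : posdef G.
Proof. exact: possemidefD_posdef (possemidef_congr _ Sp) Vp. Qed.

(** Completing the square in the gain L: the left side is the error covariance for the gain L, K is
    the Kalman gain, and K G = S C^T removes the cross terms. *)
Lemma joseph_form (L : 'M[R]_n) :
  (1%:M - L *m C) *m S *m (1%:M - L *m C)^T + L *m V *m L^T
  = filtered_cov + (L - K) *m G *m (L - K)^T.
Proof.
have Gu := posdef_unitmx Gp.
have KT : K^T = invmx G *m C *m S.
  by rewrite /K !trmx_mul trmxK trmx_inv (proj1 Gp) (proj1 Sp) mulmxA.
have KG : K *m G = S *m C^T by rewrite /K mulmxKV.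
have GK : G *m K^T = C *m S by rewrite KT !mulmxA mulmxV // mul1mx.
have -> : (L - K) *m G *m (L - K)^T
    = L *m G *m L^T - L *m C *m S - S *m C^T *m L^T
      + S *m C^T *m invmx G *m C *m S.
  rewrite linearB /= mulmxBl KG mulmxBr !mulmxBl -(mulmxA L G K^T) GK KT !mulmxA.
  by rewrite opprB addrA addrAC; congr (_ + _); rewrite addrAC.
rewrite /filtered_cov -/G linearB /= trmx1 trmx_mul.
rewrite !(mulmxBl, mulmxBr, mul1mx, mulmx1) /G mulmxDr mulmxDl !mulmxA.
set a := S *m C^T *m L^T; set b := L *m C *m S; set e := _ *m invmx _ *m _ *m _.
set h := L *m C *m S *m C^T *m L^T; set k := L *m V *m L^T.
by apply/matrixP => i j; rewrite !mxE; ring.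
Qed.

(** The excess in [joseph_form] is a congruence of the positive definite G, so every gain L yields
    an upper bound. *)
Lemma filtered_cov_le (L : 'M[R]_n) (x : 'cV[R]_n) :
  qform filtered_cov x
  <= qform S ((1%:M - L *m C)^T *m x) + qform V (L^T *m x).
Proof.
rewrite -!qform_congr -qformD joseph_form qformD lerDl qform_congr.
exact: possemidef_qform (posdef_possemidef Gp).
Qed.

Lemma filtered_cov_ge0 : possemidef filtered_cov.
Proof.
(* At L = K the excess vanishes and the filtered covariance becomes a sum of two congruences of
   semidefinite matrices. *)
have := joseph_form K; rewrite subrr !mul0mx addr0 => <-; split=> [|x].
  have [VK _] := possemidef_congr K (posdef_possemidef Vp).
  have [SK _] := possemidef_congr (1%:M - K *m C) Sp.
  by rewrite linearD /= VK SK.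
rewrite -/(qform _ x) qformD !qform_congr addr_ge0 //.
  exact: possemidef_qform.
exact: possemidef_qform (posdef_possemidef Vp).
Qed.

End RiccatiUpdate.

(** With C, V and the gain diagonal, replacing S by s I decouples the coordinates. Each one is a
    scalar Kalman update, with value s v / (s c^2 + v) = s / (1 + s c^2 / v), which decreases in c^2
    / v >= d. *)
Lemma filtered_cov_diag_le (R : realType) n (S : 'M[R]_n) (c v : 'rV[R]_n)
    (s d : R) :
  possemidef S -> 0 < s -> 0 <= d ->
  (forall x, qform S x <= s * sqnorm x) ->
  (forall i, 0 < v 0 i) -> (forall i, d <= c 0 i ^+ 2 / v 0 i) ->
  forall x, qform (filtered_cov (diag_mx c) (diag_mx v) S) x
            <= s / (1 + s * d) * sqnorm x.
Proof.
move=> Sp s0 d0 Ss v0 cd x.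
(* The minimizer of s (1 - l c)^2 + v l^2 in each coordinate. *)
pose l : 'rV[R]_n := \row_i (s * c 0 i / (s * c 0 i ^+ 2 + v 0 i)).
apply: le_trans (filtered_cov_le _ _ Sp (diag_mx l) x) _.
  exact: posdef_diag.
have -> : (1%:M - diag_mx l *m diag_mx c)^T = diag_mx (\row_i (1 - l 0 i * c 0 i)).
  by rewrite mulmx_diag -diag_const_mx -linearB tr_diag_mx; congr diag_mx; apply/rowP => i; rewrite !mxE.
rewrite tr_diag_mx qform_diag.
apply: le_trans (lerD (Ss _) (lexx _)) _; rewrite !sqnormE !mulr_sumr -big_split.
apply: ler_sum => i _ /=.
have -> : (diag_mx (\row_i (1 - l 0 i * c 0 i)) *m x) i 0
    = (1 - s * c 0 i / (s * c 0 i ^+ 2 + v 0 i) * c 0 i) * x i 0.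
  by rewrite mul_diag_mx !mxE.
have -> : (diag_mx l *m x) i 0 = s * c 0 i / (s * c 0 i ^+ 2 + v 0 i) * x i 0.
  by rewrite mul_diag_mx !mxE.
have w0 : 0 < s * c 0 i ^+ 2 + v 0 i by rewrite ltr_wpDl // mulr_ge0 ?sqr_ge0 // ltW.
have e0 : 0 < 1 + s * d by rewrite ltr_wpDr // mulr_ge0 // ltW.
set t := s * c 0 i / _.
have key : s * (1 - t * c 0 i) ^+ 2 + v 0 i * t ^+ 2 <= s / (1 + s * d).
  have -> : s * (1 - t * c 0 i) ^+ 2 + v 0 i * t ^+ 2
      = s * v 0 i / (s * c 0 i ^+ 2 + v 0 i).
    by rewrite /t; field; rewrite gt_eqF.
  have := cd i; rewrite ler_pdivlMr // => cdi.
  rewrite ler_pdivrMr // mulrAC ler_pdivlMr // -!mulrA ler_pM2l //.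
  by nra.
rewrite [X in X <= _](_ : _ = (s * (1 - t * c 0 i) ^+ 2 + v 0 i * t ^+ 2) * x i 0 ^+ 2).
  by rewrite ler_wpM2r ?sqr_ge0.
by ring.
Qed.

(** * Scalar estimates: logarithm of the determinant against the trace, and the gain inequality *)

Lemma ln_lt_half (R : realType) (x : R) : 0 < x -> ln x < x / 2.
Proof.
move=> x0; rewrite -ltr_expR lnK //.
(* Halving the exponent gives exp(x/2) = exp(x/4)^2 > (1 + x/4)^2 = (1 - x/4)^2 + x >= x. *)
have -> : x / 2 = x / 4 + x / 4 by field.
have : 1 + x / 4 < expR (x / 4) by apply: expR_gt1Dx; rewrite gt_eqF // divr_gt0.
rewrite expRD; set e := expR _ => h.
have := mulr_gt0 (_ : 0 < e - (1 + x / 4)) (_ : 0 < e + (1 + x / 4)).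
have := sqr_ge0 (1 - x / 4).
rewrite subr_gt0 h => h1 /(_ isT); have -> : 0 < e + (1 + x / 4) by lra.
move=> /(_ isT); nra.
Qed.

Lemma ln_prod_lt_half (R : realType) (s : seq R) : (0 < size s)%N ->
  (forall x, x \in s -> 0 < x) -> ln (\prod_(x <- s) x) < (\sum_(x <- s) x) / 2.
Proof.
elim: s => // x [|y s] IH _ s0.
  by rewrite !big_seq1 ln_lt_half // s0 ?mem_head.
have s'0 z : z \in y :: s -> 0 < z by move=> zs; rewrite s0 // inE zs orbT.
have x0 : 0 < x by rewrite s0 ?mem_head.
have P0 : 0 < \prod_(z <- y :: s) z by rewrite big_seq; exact: prodr_gt0.
by rewrite !(big_cons _ _ x) lnM ?posrE // mulrDl ltrD ?IH // ln_lt_half.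
Qed.

Lemma ln_det_lt_half_trace (R : realType) n (M : 'M[R]_n) :
  (0 < n)%N -> posdef M -> ln (\det M) < \tr M / 2.
Proof.
move=> n0 Mp; have Ms := proj1 Mp.
rewrite det_spectrum // mxtrace_spectrum // ln_prod_lt_half //.
  by rewrite size_spectrum.
by move=> x; exact: posdef_spectrum_gt0.
Qed.

(** To be read with a = s_1(A)^2, d the least C_ii^2 / sigma_i^2, g the largest gamma_i, w =
    lambda_1(W), s = lambda_1(Sigma) and e = eta. The cases a <= 1 and a > 1 need different
    estimates of a g + w. *)
Lemma filtered_gain_bound (R : realType) (a d g w s e : R) :
  0 <= a -> 0 <= d -> 0 < s -> 0 <= w -> w <= s -> s <= a * (s / (1 + s * d)) + w ->
  0 <= g -> g <= w -> g * d <= 1 -> e <= a * g + w ->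
  s / (1 + s * d) * (1 + e * d - a) <= 2 * w.
Proof.
move=> a0 d0 s0 w0 ws sw g0 gw gd ew.
have sd0 : 0 <= s * d by rewrite mulr_ge0 // ltW.
have q0 : 0 < 1 + s * d by lra.
move: sw; set p := s / (1 + s * d) => sw.
have p0 : 0 <= p by rewrite divr_ge0 // ltW.
have pE : p * (1 + s * d) = s by rewrite /p divfK // gt_eqF.
have ed : e * d <= (a * g + w) * d by rewrite ler_wpM2r.
have [a1|a1] := leP a 1.
  (* For a <= 1, g <= w <= s gives e d <= 2 s d. Then p (1 + 2 s d - a) = 2 s - p (1 + a), and s <=
     a p + w bounds this by 2 w - p (1 - a). *)
  have agw : a * g + w <= 2 * s by nra.
  have h1 : (a * g + w) * d <= 2 * s * d by rewrite ler_wpM2r.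
  have h2 : p * (1 + e * d - a) <= p * (1 + 2 * s * d - a).
    by rewrite ler_wpM2l //; lra.
  have h3 : 0 <= p * (1 - a) by rewrite mulr_ge0 // subr_ge0.
  nra.
(* For a > 1, 1 + a g d - a = g d - (a - 1) (1 - g d) <= g d. With p d <= 1, the two summands of a g
   + w then contribute at most g <= w and w. *)
have pd : p * d <= 1 by rewrite /p mulrAC ler_pdivrMr // mul1r; lra.
have h2 : p * (1 + e * d - a) <= p * (1 + (a * g + w) * d - a).
  by rewrite ler_wpM2l //; lra.
have h3 : 1 + a * (g * d) - a <= g * d by nra.
have h4 : p * (1 + a * (g * d) - a) <= p * (g * d) by rewrite ler_wpM2l.
have h5 : p * d * g <= 1 * g by rewrite ler_wpM2r.
have h6 : p * d * w <= 1 * w by rewrite ler_wpM2r.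
lra.
Qed.

(** The square root sends negative numbers to 0, so this passes from eigenvalues of A^T A to squared
    singular values without a proof that those eigenvalues are nonnegative. *)
Lemma le_sqr_sqrt (R : realType) (x : R) : x <= Num.sqrt x ^+ 2.
Proof.
by have [x0|x0] := leP 0 x; [rewrite sqr_sqrtr | rewrite (le_trans (ltW x0)) ?sqr_ge0].
Qed.

(** * Block diagonal matrices and the diagonal form of the privacy term *)

Section Mxdiag.
Variables (R : realType) (N : nat) (n_ : 'I_N -> nat) (M_ : forall i, 'M[R]_(n_ i)).

Lemma qform_mxdiag (x : 'cV[R]_(\sum_i n_ i)) :
  qform (\mxdiag_(i < N) M_ i) x = \sum_i qform (M_ i) (submxcol x i).
Proof.
rewrite /qform -{1 2}[x]submxcolK tr_mxcol mul_mxrow_mxdiag mul_mxrow_mxcol.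
by rewrite summxE.
Qed.

Lemma posdef_mxdiag : (forall i, posdef (M_ i)) -> posdef (\mxdiag_(i < N) M_ i).
Proof.
move=> Mp; split=> [|x x0].
  by rewrite tr_mxdiag; apply: eq_mxdiag => i; exact: (proj1 (Mp i)).
have M0 i : 0 <= qform (M_ i) (submxcol x i).
  exact: possemidef_qform (posdef_possemidef (Mp i)).
rewrite -/(qform _ x) qform_mxdiag lt_def sumr_ge0 // andbT.
apply: contra x0 => /eqP /psumr_eq0P Mx; apply/eqP.
rewrite -[x]submxcolK -[0]submxcolK; apply: eq_mxcol => i; rewrite submxcol0.
apply/eqP; apply: contraT => xi0.
by have := posdef_qform (Mp i) xi0; rewrite Mx ?ltxx.
Qed.

Lemma mxdiag_is_diag : (forall i, is_diag_mx (M_ i)) ->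
  is_diag_mx (\mxdiag_(i < N) M_ i).
Proof.
move=> Md; apply/is_diag_mxP => i j ij; rewrite mxE.
(* A global index is a pair of a block and a position in it. Entries across two blocks are 0; within
   one block, distinct global indices mean distinct positions. *)
have : tagnat.Rank (tagnat.sig1 i) (tagnat.sig2 i)
    != tagnat.Rank (tagnat.sig1 j) (tagnat.sig2 j) by rewrite !tagnat.sig2K.
move: (tagnat.sig1 i) (tagnat.sig2 i) (tagnat.sig1 j) (tagnat.sig2 j) => s i' t j'.
have [st|st _] := eqVneq s t; last by rewrite mxE.
case: t / st j' => j' ij'; rewrite conform_mx_id.
have /is_diag_mxP Mds := Md s; apply: Mds.
by apply: contra ij' => /eqP/val_inj->.
Qed.

End Mxdiag.

Lemma diag_mxE (R : realType) n (M : 'M[R]_n) : is_diag_mx M ->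
  M = diag_mx (\row_i M i i).
Proof.
move=> /is_diag_mxP Md; apply/matrixP => i j; rewrite !mxE.
by have [->|ij] := eqVneq i j; rewrite ?mulr1n // mulr0n Md.
Qed.

Lemma noise_precision (R : realType) n (C : 'M[R]_n) (sigma : 'I_n -> R) :
  is_diag_mx C -> (forall i, 0 < sigma i) ->
  C^T *m invmx (noise_cov sigma) *m C
  = diag_mx (\row_i (C i i ^+ 2 / sigma i ^+ 2)).
Proof.
move=> Cd s0; set V := noise_cov sigma.
pose D : 'M[R]_n := diag_mx (\row_i (sigma i ^+ 2)^-1).
have VD : V *m D = 1%:M.
  rewrite mulmx_diag -diag_const_mx; congr diag_mx; apply/rowP => i.
  by rewrite !mxE divff // expf_neq0 // gt_eqF.
have -> : invmx V = D by rewrite -[LHS]mulmx1 -VD mulKmx // (proj1 (mulmx1_unit VD)).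
rewrite [in LHS](diag_mxE Cd) tr_diag_mx !mulmx_diag; congr diag_mx.
by apply/rowP => i; rewrite !mxE expr2 mulrAC.
Qed.

Lemma privacy_termE (R : realType) n (A C W : 'M[R]_n) (sigma : 'I_n -> R) :
  (0 < n)%N -> is_diag_mx C -> (forall i, 0 < sigma i) ->
  privacy_term A C W sigma =
    eta A C W sigma * fmin (fun i => C i i ^+ 2 / sigma i ^+ 2).
Proof.
move=> n0 Cd s0; rewrite /privacy_term noise_precision // eigvaln_diag //.
by congr (_ * fmin _); apply/funext => i; rewrite mxE.
Qed.

Lemma eigval1_Gam (R : realType) n (C W : 'M[R]_n) (sigma : 'I_n -> R) :
  (0 < n)%N -> eigval (Gam C W sigma) 1 = fmax (gam C W sigma).
Proof.
move=> n0; rewrite /Gam eigval1_diag //.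
by congr fmax; apply/funext => i; rewrite mxE.
Qed.

(** * The bound for Riccati solutions, and the theorem *)

Lemma ln_det_dare_lt (R : realType) n (A C W S : 'M[R]_n) (sigma : 'I_n -> R) :
  (0 < n)%N -> is_diag_mx C -> posdef W -> (forall i, 0 < sigma i) ->
  possemidef S -> dare A C W (noise_cov sigma) S ->
  0 < 1 + privacy_term A C W sigma - singval A 1 ^+ 2 ->
  ln (\det S) < logdet_bound A C W sigma.
Proof.
move=> n0 Cd Wp sig0 Sp dS; rewrite privacy_termE // /logdet_bound.
rewrite privacy_termE //; set d := fmin _.
set a := singval A 1 ^+ 2; set f := \sum_(1 <= i < n.+1) _.
set w := eigval W 1; set P := filtered_cov C (noise_cov sigma) S.
set e := eta A C W sigma; move=> den0.
(* The Riccati equation is this identity up to unfolding [filtered_cov]. *)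
have SE : S = A *m P *m A^T + W := dS.
have Vp : posdef (noise_cov sigma).
  by apply: posdef_diag => i; rewrite mxE exprn_gt0.
have Pp : possemidef P := filtered_cov_ge0 _ Vp Sp.
have APp : possemidef (A *m P *m A^T) := possemidef_congr A Pp.
have Spos : posdef S by rewrite SE; exact: possemidefD_posdef.
have Wsym := proj1 Wp; have Ssym := proj1 Sp.
have w0 : 0 < w := eigval1_gt0 n0 Wp.
set s := eigval S 1.
(* Sigma dominates W, since A P A^T is semidefinite. *)
have ws : w <= s.
  apply: eigval1_le => // x.
  apply: le_trans (qform_le_eigval1 Ssym x).
  by rewrite [X in _ <= qform X _]SE qformD lerDr; exact: possemidef_qform.
have s0 : 0 < s := lt_le_trans w0 ws.
have d0 : 0 <= d.
  have /codomP[i ->] : d \in codom (fun i => C i i ^+ 2 / sigma i ^+ 2).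
    by rewrite fmin_codom // card_ord.
  by rewrite divr_ge0 ?sqr_ge0.
pose p := s / (1 + s * d).
have p0 : 0 <= p by rewrite divr_ge0 ?addr_ge0 ?mulr_ge0 // ltW.
have Pp_le x : qform P x <= p * sqnorm x.
  rewrite /P (diag_mxE Cd).
  apply: filtered_cov_diag_le => // [y|i|i].
  - exact: qform_le_eigval1.
  - by rewrite mxE exprn_gt0.
  - by rewrite !mxE; exact: (fmin_le (fun i => C i i ^+ 2 / sigma i ^+ 2)).
have Aa x : sqnorm (A *m x) <= a * sqnorm x.
  apply: le_trans (sqnorm_mul_le _ x) _.
  by rewrite ler_wpM2r ?sqnorm_ge0 ?le_sqr_sqrt.
have a0 : 0 <= a by rewrite sqr_ge0.
have APA x : qform (A *m P *m A^T) x <= p * sqnorm (A^T *m x).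
  by rewrite qform_congr.
have sw : s <= a * p + w.
  apply: eigval1_le => // x; rewrite [X in qform X _ <= _]SE qformD mulrDl lerD ?qform_le_eigval1 //.
  apply: le_trans (APA x) _; rewrite -mulrA mulrCA ler_wpM2l //.
  exact: sqnorm_trmul_le.
(* Summing over the basis vectors bounds the trace by p times the squared Frobenius norm of A^T,
   which is tr(A^T A), the sum of the eigenvalues of A^T A. *)
have trAPA : \tr (A *m P *m A^T) <= p * f.
  apply: le_trans (mxtrace_le_qform APA) _; rewrite ler_wpM2l //.
  have -> : \sum_i sqnorm (A^T *m delta_mx i 0) = \tr (A^T *m A).
    rewrite mxtrace_mulC; apply: eq_bigr => i _.
    by rewrite -qform_tr_mul trmxK qform_delta.
  rewrite -sum_eigval ?trmx_mul ?trmxK //.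
  by rewrite ler_sum // => i _; exact: le_sqr_sqrt.
have f0 : 0 <= f by rewrite sumr_ge0 // => i _; rewrite sqr_ge0.
set g := fmax (gam C W sigma).
have Wii i : 0 < W i i.
  rewrite -qform_delta posdef_qform // -sqnorm_eq0 sqnorm_delta.
  exact: oner_neq0.
have [i gE] : exists i, g = gam C W sigma i.
  by apply/codomP; rewrite fmax_codom // card_ord.
have gden : 0 < sigma i ^+ 2 + C i i ^+ 2 * W i i.
  by rewrite ltr_pwDl ?exprn_gt0 // mulr_ge0 ?sqr_ge0 // ltW.
have g0 : 0 <= g by rewrite gE divr_ge0 ?mulr_ge0 ?sqr_ge0 // ltW.
have gw : g <= w.
  have WW : W i i <= w.
    by have := qform_le_eigval1 Wsym (delta_mx i 0);
      rewrite qform_delta sqnorm_delta mulr1.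
  apply: le_trans WW; rewrite gE ler_pdivrMr // mulrC ler_pM2l //.
  by rewrite lerDl mulr_ge0 ?sqr_ge0 // ltW.
(* At the index i attaining g, d <= C_ii^2 / sigma_i^2, so g d <= C_ii^2 W_ii / (sigma_i^2 + C_ii^2
   W_ii) <= 1. *)
have gd : g * d <= 1.
  have := fmin_le (fun i => C i i ^+ 2 / sigma i ^+ 2) i; rewrite -/d.
  rewrite ler_pdivlMr ?exprn_gt0 // => di.
  rewrite gE /gam mulrAC ler_pdivrMr // mul1r.
  have := ler_wpM2r (ltW (Wii i)) di; have : 0 <= sigma i ^+ 2 by rewrite sqr_ge0.
  lra.
(* Replace s_n(A) by s_1(A) and lambda_n(W) by lambda_1(W). *)
have ew : e <= a * g + w.
  rewrite /e /eta eigval1_Gam // -/g lerD //.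
    rewrite ler_wpM2r // lerXn2r ?nnegrE ?sqrtr_ge0 // ler_wsqrtr //.
    apply: eigval1_max; rewrite eigval_spectrum ?n0 ?leqnn //.
    by rewrite trmx_mul trmxK.
  by apply: eigval1_max; rewrite eigval_spectrum ?n0 ?leqnn.
have := filtered_gain_bound a0 d0 s0 (ltW w0) ws sw g0 gw gd ew.
rewrite -/p -ler_pdivlMr // => pw.
apply: lt_le_trans (ln_det_lt_half_trace n0 Spos) _.
rewrite SE mxtraceD.
have trW : 0 <= \tr W by rewrite sumr_ge0 // => j _; rewrite ltW.
(* The factor 2 is absorbed by the half in tr(Sigma) / 2; the other half of tr(W) is dropped, as
   tr(W) >= 0. *)
have pf : p * f <= 2 * (w / (1 + e * d - a) * f).
  by rewrite !mulrA ler_wpM2r.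
lra.
Qed.

Unset Implicit Arguments.

Theorem theorem1 (R : realType) (N : nat) (n_ m_ : 'I_N -> nat)
    (A_ : forall i, 'M[R]_(n_ i))
    (B_ : forall i, 'M[R]_(n_ i, m_ i))
    (C_ : forall i, 'M[R]_(n_ i))
    (W_ : forall i, 'M[R]_(n_ i))
    (epsilon delta b : 'I_N -> R)
    (sigma : 'I_(\sum_i n_ i) -> R)
    (Q : 'M[R]_(\sum_i n_ i)) (Rc : 'M[R]_(\sum_i m_ i))
    (Sigma : 'M[R]_(\sum_i n_ i)) :
  let n := (\sum_i n_ i)%N in
  let A := \mxdiag_(i < N) A_ i in
  let B := blockdiag B_ in
  let C := \mxdiag_(i < N) C_ i in
  let W := \mxdiag_(i < N) W_ i in
  let V := noise_cov sigma in
  (0 < n)%N ->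
  (forall i, posdef (W_ i)) ->
  (forall i, 0 < epsilon i) ->
  (forall i, 0 < delta i < 1 / 2) ->
  (forall i, 0 < b i) ->
  (forall j, 0 < sigma j) ->
  (forall j k, tagnat.sig1 j = tagnat.sig1 k -> sigma j = sigma k) ->
  (forall j, let i := tagnat.sig1 j in
     kappa (delta i) (epsilon i) * singval (C_ i) 1 * b i <= sigma j) ->
  (forall i, is_diag_mx (C_ i)) ->
  posdef Q -> posdef Rc -> controllable A B ->
  (exists (p : nat) (F : 'M[R]_(p, n)), C = F^T *m F /\ observable A F) ->
  unique (fun S => possemidef S /\ dare A C W V S) Sigma ->
  singval A 1 ^+ 2
    < 1 + (singval A n ^+ 2 * eigval (Gam C W sigma) 1 + eigval W n)
          * fmin (fun i => C i i ^+ 2 / sigma i ^+ 2) ->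
  [/\ ln (\det Sigma) < logdet_bound A C W sigma,
      privacy_term A C W sigma
        = singval A n ^+ 2
            * fmax (fun i => sigma i ^+ 2 * W i i
                             / (sigma i ^+ 2 + C i i ^+ 2 * W i i))
            * fmin (fun i => C i i ^+ 2 / sigma i ^+ 2)
          + eigval W n * fmin (fun i => C i i ^+ 2 / sigma i ^+ 2)
    & exists c0 c1 c2 c3 : R, forall s : 'I_n -> R,
        logdet_bound A C W s
          = c0 / (1 + privacy_term A C W s - c1) * c2 + c3].
Proof.
move=> n A B C W V n0 Wp _ _ _ sigma0 _ _ Cd _ _ _ _ [[Sp dS] _] gap.
have CD : is_diag_mx C := mxdiag_is_diag Cd.
have WP : posdef W := posdef_mxdiag Wp.
split.
- apply: ln_det_dare_lt => //.
  (* Once the privacy term is made explicit, [gap] is exactly the positivity of the denominator. *)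
  by rewrite privacy_termE // subr_gt0.
- by rewrite privacy_termE // /eta eigval1_Gam // mulrDl.
(* The four constants involve only A and W and are chosen before s, so the noise levels enter
   through [privacy_term] alone. *)
- exists (eigval W 1), (singval A 1 ^+ 2).
  by exists (\sum_(1 <= i < n.+1) singval A i ^+ 2), (\tr W).
Qed.
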